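(* Let $n\ge1$, $0<\alpha<1$, let $\Omega\subset\mathbb{R}^n$ be a bounded domain, and let $f\in C(\Omega)$ be bounded with $f\le0$. Let $u$ be a viscosity supersolution and $v$ a viscosity subsolution to $\mathcal{L}_\infty w=f$ in $\Omega$. Assume that $u$ is bounded on $\mathbb{R}^n\setminus\Omega$, that $u\ge v$ on $\mathbb{R}^n\setminus\Omega$, and that the limits $\lim_{|x|\to\infty}u(x)=C_1$ and $\lim_{|x|\to\infty}v(x)=C_2$ exist (as finite real numbers). Then $u\ge v$ in $\Omega$.
   Context: For $0<\alpha\le1$ and a function $\varphi:\mathbb{R}^n\to\mathbb{R}$, the nonlocal infinity Laplacian is $\mathcal{L}_\infty\varphi(x)=\mathcal{L}^+_\infty\varphi(x)+\mathcal{L}^-_\infty\varphi(x)$, where $\mathcal{L}^+_\infty\varphi(x)=\sup_{y\in\mathbb{R}^n}\frac{\varphi(y)-\varphi(x)}{|x-y|^\alpha}$ and $\mathcal{L}^-_\infty\varphi(x)=\inf_{y\in\mathbb{R}^n}\frac{\varphi(y)-\varphi(x)}{|x-y|^\alpha}$ (with $y\neq x$). Viscosity supersolution: a lower semicontinuous $u:\mathbb{R}^n\to\mathbb{R}$ with $|u(x)|\le C(1+|x|)^\beta$ for some $C>0$, $\beta<\alpha$, is a viscosity supersolution to $\mathcal{L}_\infty u=f$ in $\Omega$ if for every $x_0\in\Omega$ and every locally Lipschitz continuous $\varphi:\mathbb{R}^n\to\mathbb{R}$ with $|\varphi(x)|\le C(1+|x|)^\beta$ for some $C>0$, $\beta<\alpha$,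 such that $\varphi(x_0)=u(x_0)$ and $u\ge\varphi$ on $\mathbb{R}^n$, one has $\mathcal{L}_\infty\varphi(x_0)\le f(x_0)$. Viscosity subsolutions are defined analogously with $u$ upper semicontinuous, $u\le\varphi$ on $\mathbb{R}^n$, and $\mathcal{L}_\infty\varphi(x_0)\ge f(x_0)$. *)

(* Defs.v *)
From HB Require Import structures.
From mathcomp Require Import all_boot all_order all_algebra.
From mathcomp Require Import all_classical all_reals all_analysis.
Set Implicit Arguments. Unset Strict Implicit. Unset Printing Implicit Defensive.
Import Order.TTheory GRing.Theory Num.Theory.
Import numFieldNormedType.Exports.
Local Open Scope classical_set_scope.
Local Open Scope ring_scope.

Section NonlocalInfLap.
Variables (R : realType) (n : nat).
Notation V := 'rV[R]_n.

Definition enorm (x : V) : R := Num.sqrt (\sum_(i < n) x ord0 i ^+ 2).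

Definition growth (alpha : R) (phi : V -> R) : Prop :=
  exists C beta : R, 0 < C /\ beta < alpha /\
    forall x, `|phi x| <= C * (1 + enorm x) `^ beta.

Definition locally_lipschitz (phi : V -> R) : Prop :=
  forall x, exists r L : R, 0 < r /\ forall y z,
    enorm (y - x) < r -> enorm (z - x) < r -> `|phi y - phi z| <= L * enorm (y - z).

Definition lsc (u : V -> R) : Prop :=
  forall x (e : R), 0 < e -> exists d : R, 0 < d /\
    forall y, enorm (y - x) < d -> u x - e < u y.

Definition usc (u : V -> R) : Prop :=
  forall x (e : R), 0 < e -> exists d : R, 0 < d /\
    forall y, enorm (y - x) < d -> u y < u x + e.

Definition diffq (alpha : R) (phi : V -> R) (x y : V) : R :=
  (phi y - phi x) / (enorm (x - y)) `^ alpha.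

Definition Lplus (alpha : R) (phi : V -> R) (x : V) : \bar R :=
  ereal_sup [set (diffq alpha phi x y)%:E | y in [set y | y != x]].

Definition Lminus (alpha : R) (phi : V -> R) (x : V) : \bar R :=
  ereal_inf [set (diffq alpha phi x y)%:E | y in [set y | y != x]].

Definition Linf (alpha : R) (phi : V -> R) (x : V) : \bar R :=
  (Lplus alpha phi x + Lminus alpha phi x)%E.

Definition visc_super (alpha : R) (Omega : set V) (f u : V -> R) : Prop :=
  lsc u /\ growth alpha u /\
  forall x0, Omega x0 -> forall phi : V -> R,
    locally_lipschitz phi -> growth alpha phi ->
    phi x0 = u x0 -> (forall x, phi x <= u x) ->
    (Linf alpha phi x0 <= (f x0)%:E)%E.

Definition visc_sub (alpha : R) (Omega : set V) (f u : V -> R) : Prop :=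
  usc u /\ growth alpha u /\
  forall x0, Omega x0 -> forall phi : V -> R,
    locally_lipschitz phi -> growth alpha phi ->
    phi x0 = u x0 -> (forall x, u x <= phi x) ->
    ((f x0)%:E <= Linf alpha phi x0)%E.

Definition eopen (Omega : set V) : Prop :=
  forall x, Omega x -> exists r : R, 0 < r /\
    forall y, enorm (y - x) < r -> Omega y.

Definition ebounded (Omega : set V) : Prop :=
  exists M : R, forall x, Omega x -> enorm x <= M.

Definition bounded_domain (Omega : set V) : Prop :=
  Omega !=set0 /\ eopen Omega /\ connected Omega /\ ebounded Omega.

Definition continuous_on (Omega : set V) (f : V -> R) : Prop :=
  forall x (e : R), Omega x -> 0 < e -> exists d : R, 0 < d /\
    forall y, Omega y -> enorm (y - x) < d -> `|f y - f x| < e.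

Definition lim_at_infty (u : V -> R) (c : R) : Prop :=
  forall e : R, 0 < e -> exists M : R, forall x, M < enorm x -> `|u x - c| < e.

End NonlocalInfLap.

(* Main.v *)
Require Import Defs.
From HB Require Import structures.
From mathcomp Require Import all_boot all_order all_algebra.
From mathcomp Require Import all_classical all_reals all_analysis.
From mathcomp Require Import ring lra.
Import Order.TTheory GRing.Theory Num.Theory.
Import numFieldNormedType.Exports.
Local Open Scope classical_set_scope.
Local Open Scope ring_scope.

(** Suppose [v - u] is positive somewhere. Both functions are bounded, and by
    semicontinuity [v - u] is small near the complement of [Omega]. Replace [u]
    by its inf-convolution [g] with the penalty [N |x - y|]: it is bounded and
    Lipschitz, hence its own test function, and [L g <= f(y) <= 0] wherever the
    minimising [y] lies in [Omega].

    Since [f <= 0], a point of [Omega] reached from [x] by the steepest descent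
    of [g], of slope [s = - L^- g x], has upward slope at least [s], hence also
    downward slope at least [s]. A second steepest step would then beat the
    slope [s] at [x], because [t `^ alpha] is strictly subadditive. So steepest
    descent leaves [Omega] (up to the scale of the inf-convolution) in one step.

    At a maximum point of [v - g], however, the test function [g + const] can be
    lowered near the complement of [Omega] and still touch [v] from above there.
    Comparing the two viscosity inequalities, this lowering would make [L^-]
    drop by a fixed amount at the end point of the steepest step, whereas the
    inequalities only leave room for the oscillation of [f]. *)

(** * The Euclidean norm on row vectors, and compactness arguments in terms of its balls *)

Section EuclideanNorm.
Set Implicit Arguments.
Unset Strict Implicit.
Context {R : realType} {n : nat}.
Implicit Types x y z : 'rV[R]_n.

Lemma enorm_ge0 x : 0 <= enorm x.
Proof. exact: sqrtr_ge0. Qed.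

Lemma sqr_enorm x : enorm x ^+ 2 = \sum_(i < n) x ord0 i ^+ 2.
Proof. by rewrite sqr_sqrtr// sumr_ge0// => i _; exact: sqr_ge0. Qed.

Lemma ler_coord_enorm x i : `|x ord0 i| <= enorm x.
Proof.
rewrite -sqrtr_sqr ler_wsqrtr// (bigD1 i)//= lerDl.
by rewrite sumr_ge0// => j _; exact: sqr_ge0.
Qed.

Lemma enorm0_eq0 x : enorm x = 0 -> x = 0.
Proof.
move=> x0; apply/rowP => i; rewrite mxE; apply/normr0_eq0/eqP.
by rewrite eq_le normr_ge0 andbT -x0 ler_coord_enorm.
Qed.

Lemma enorm0 : enorm (0 : 'rV[R]_n) = 0.
Proof.
by rewrite /enorm big1 ?sqrtr0// => i _; rewrite mxE expr0n.
Qed.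

Lemma enormN x : enorm (- x) = enorm x.
Proof.
by rewrite /enorm; congr Num.sqrt; apply: eq_bigr => i _; rewrite mxE sqrrN.
Qed.

Lemma enormBC x y : enorm (x - y) = enorm (y - x).
Proof. by rewrite -enormN opprB. Qed.

Lemma enormB_gt0 x y : (0 < enorm (x - y)) = (x != y).
Proof.
rewrite lt_neqAle enorm_ge0 andbT eq_sym; congr (~~ _).
by apply/eqP/eqP => [/enorm0_eq0/eqP|->]; rewrite ?subrr ?enorm0// subr_eq0 => /eqP.
Qed.

(** Cauchy-Schwarz: with [p], [q] the two norms, the sum of the squares of [q * x_i - p * y_i] is
    [2 * p * q] times the difference of the two sides. *)
Lemma dot_le_enorm x y :
  \sum_(i < n) x ord0 i * y ord0 i <= enorm x * enorm y.
Proof.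
have [p0|p0] := eqVneq (enorm x) 0.
  by rewrite p0 mul0r (enorm0_eq0 p0) big1// => i _; rewrite mxE mul0r.
have [q0|q0] := eqVneq (enorm y) 0.
  by rewrite q0 mulr0 (enorm0_eq0 q0) big1// => i _; rewrite mxE mulr0.
have p_gt0 : 0 < enorm x by rewrite lt_neqAle eq_sym p0 enorm_ge0.
have q_gt0 : 0 < enorm y by rewrite lt_neqAle eq_sym q0 enorm_ge0.
set p := enorm x in p_gt0 *; set q := enorm y in q_gt0 *.
set D := (X in X <= _).
have : 0 <= \sum_(i < n) (q * x ord0 i - p * y ord0 i) ^+ 2.
  by apply: sumr_ge0 => i _; exact: sqr_ge0.
under eq_bigr => i _.
  have -> : (q * x ord0 i - p * y ord0 i) ^+ 2 = q ^+ 2 * x ord0 i ^+ 2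
     + (- (2 * p * q)) * (x ord0 i * y ord0 i) + p ^+ 2 * y ord0 i ^+ 2 by ring.
  over.
rewrite !big_split/= -!mulr_sumr -!sqr_enorm -/p -/q -/D.
have -> : q ^+ 2 * p ^+ 2 + - (2 * p * q) * D + p ^+ 2 * q ^+ 2
  = (2 * p * q) * (p * q - D) by ring.
by rewrite pmulr_rge0 ?subr_ge0// !mulr_gt0.
Qed.

Lemma enormD x y : enorm (x + y) <= enorm x + enorm y.
Proof.
rewrite -(@ler_pXn2r _ 2)// ?nnegrE ?addr_ge0 ?enorm_ge0//.
rewrite sqr_enorm sqrrD !sqr_enorm.
under eq_bigr do rewrite mxE sqrrD.
rewrite !big_split/= lerD2r lerD2l mulr2n.
by apply: lerD; exact: dot_le_enorm.
Qed.

Lemma enorm_triangle z x y : enorm (x - y) <= enorm (x - z) + enorm (z - y).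
Proof. by have := enormD (x - z) (z - y); rewrite addrA subrK. Qed.

(** Bridge to the library topology, which comes from the max norm. Dividing [r] by [n + 1] rather
    than [n] makes the estimate strict and covers [n = 0]. *)
Lemma enorm_nbhs x (r : R) : 0 < r -> \forall y \near x, enorm (y - x) < r.
Proof.
move=> r0; have n0 : 0 < n.+1%:R :> R by rewrite ltr0n.
apply/nbhs_normP; exists (r / n.+1%:R) => /=; first exact: divr_gt0.
move=> y /=; set e := r / n.+1%:R => xye.
have e0 : 0 < e by exact: divr_gt0.
have ci i : `|(y - x) ord0 i| <= e.
  have : `|(x - y) ord0 i| <= `|x - y|.
    rewrite [leRHS]mx_normrE.
    exact: (le_bigmax _ (fun ij : 'I_1 * 'I_n => `|(x - y) ij.1 ij.2|) (ord0, i)).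
  by rewrite !mxE distrC => /le_trans; apply; exact: ltW.
have -> : r = n.+1%:R * e by rewrite /e mulrC divfK ?gt_eqF.
clearbody e.
rewrite -(@ltr_pXn2r _ 2)// ?nnegrE ?enorm_ge0 ?mulr_ge0 ?ltW//.
rewrite sqr_enorm; apply: (@le_lt_trans _ _ (\sum_(i < n) e ^+ 2)).
  apply: ler_sum => i _; have := ci i; move: ((y - x) ord0 i) => w.
  by rewrite ler_norml => /andP[]; nra.
rewrite sumr_const card_ord -[X in X < _]mulr_natl exprMn ltr_pM2r ?exprn_gt0//.
by rewrite -natrX ltr_nat (@leq_trans n.+1)// expnS leq_pmulr.
Qed.

Lemma enorm_bounded (A : set 'rV[R]_n) (b : R) :
  (forall a, A a -> enorm a <= b) -> bounded_set A.
Proof.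
move=> Ab; exists b; split; first exact: num_real.
move=> M bM a Aa /=; rewrite [leLHS]mx_normrE.
have bE := le_trans (enorm_ge0 a) (Ab a Aa).
apply: bigmax_le => [|[i j] _ /=]; first exact: le_trans bE (ltW bM).
rewrite (ord1 i); apply: le_trans (ler_coord_enorm _ _) _.
by apply: le_trans (Ab _ Aa) _; exact: ltW.
Qed.

Lemma far_point (t : R) : (0 < n)%N -> 0 <= t -> exists x : 'rV[R]_n, enorm x = t.
Proof.
move=> n0 t0; pose i0 := Ordinal n0; exists (t *: delta_mx ord0 i0).
rewrite /enorm (bigD1 i0)//= big1 ?addr0.
  by rewrite !mxE !eqxx mulr1 sqrtr_sqr ger0_norm.
by move=> j ji; rewrite !mxE (negbTE ji) andbF mulr0 expr0n.
Qed.

(** Closed bounded sets are compact, so the local radii admit a common positive value, found along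
    the filter of positive reals tending to 0. *)
Lemma uniform_on_compact (A : set 'rV[R]_n) (b : R) (P : R -> 'rV[R]_n -> Prop) :
  eopen (~` A) -> (forall a, A a -> enorm a <= b) ->
  (forall r s x, s <= r -> P r x -> P s x) ->
  (forall a, A a -> exists r, 0 < r /\ forall x, enorm (x - a) < r -> P r x) ->
  exists r, 0 < r /\ forall a, A a -> P r a.
Proof.
move=> oA Ab Pmono loc.
have clA : closed A.
  rewrite -openC openE => x /oA[r [r0 xr]].
  by near=> y; apply: xr; near: y; exact: enorm_nbhs.
have /compact_near_coveringP cov := bounded_closed_compact (enorm_bounded Ab) clA.
have /(cov R 0^'+ P) : forall x : 'rV[R]_n, A x -> \forall x' \near x & i \near 0^'+, P i x'.
  move=> a /loc[r [r0 Pr]].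
  exists ([set x | enorm (x - a) < r], [set s | s < r]) => /=.
    by split; [exact: enorm_nbhs | exact: nbhs_right_lt].
  by move=> [x s] /= [xa sr]; exact: (Pmono r _ _ (ltW sr) (Pr x xa)).
move=> nearP; have [r [r0 Ar]] := filter_ex (filterI (@nbhs_right_gt R 0) nearP).
by exists r.
Unshelve. all: by end_near. Qed.

Lemma lsc_bounded_below (A : set 'rV[R]_n) (b : R) (g : 'rV[R]_n -> R) :
  eopen (~` A) -> (forall a, A a -> enorm a <= b) -> lsc g ->
  exists m, forall a, A a -> m <= g a.
Proof.
move=> oA Ab lg.
(* The bound [- r^-1] weakens as [r] decreases to 0; the disjunct [r <= 0] keeps the predicate
   monotone past the sign change of the inverse. *)
have [||r [r0 Ar]] := @uniform_on_compact A b (fun r x => - r^-1 <= g x \/ r <= 0) oA Ab.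
- move=> r s x sr [h|h]; last by right; lra.
  have [s0|s0] := lerP s 0; first by right.
  by left; apply: le_trans h; rewrite lerN2 lef_pV2// posrE; lra.
- move=> a Aa; have [d [d0 ad]] := lg a 1 ltr01.
  have h0 : 0 < `|g a| + 1 by have := normr_ge0 (g a); lra.
  exists (Num.min d (`|g a| + 1)^-1); split; first by rewrite lt_min d0 invr_gt0.
  move=> x; rewrite lt_min => /andP[/ad gx _]; left.
  apply: le_trans (ltW gx); rewrite lerNl.
  apply: (@le_trans _ _ (`|g a| + 1)).
    by have := ler_norm (- g a); rewrite normrN; lra.
  by rewrite -[leLHS]invrK lef_pV2 ?posrE ?lt_min ?d0 ?invr_gt0// ge_min lexx orbT.
by exists (- r^-1) => a /Ar[//|]; lra.
Qed.

(** Were the infimum not attained, [g] would exceed it near each point by a positive margin;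
    compactness makes the margin uniform, which is absurd. *)
Lemma lsc_attains_min (A : set 'rV[R]_n) (b : R) (g : 'rV[R]_n -> R) :
  eopen (~` A) -> (forall a, A a -> enorm a <= b) -> lsc g -> A !=set0 ->
  exists2 z, A z & forall a, A a -> g z <= g a.
Proof.
move=> oA Ab lg [a0 Aa0]; have [m Am] := lsc_bounded_below oA Ab lg.
apply: contrapT => /forall2NP nomin.
have hi : has_inf (g @` A).
  by split; [exists (g a0), a0|exists m => _ [a Aa <-]; exact: Am].
have gtI a : A a -> inf (g @` A) < g a.
  move=> Aa; rewrite ltNge; apply/negP => gaI.
  have [//|h] := nomin a; case: h => c Ac; apply: le_trans gaI _.
  by apply: ge_inf; [exact: hi.2|exists c].
have [||r [r0 Ar]] := @uniform_on_compact A b (fun r x => inf (g @` A) + r <= g x) oA Ab.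
- by move=> r s x sr h; lra.
- move=> a Aa; have h := gtI a Aa.
  have h2 : 0 < (g a - inf (g @` A)) / 2 by lra.
  have [d [d0 ad]] := lg a _ h2.
  exists (Num.min d ((g a - inf (g @` A)) / 2)); split; first by rewrite lt_min d0.
  move=> x; rewrite lt_min => /andP[/ad gx _].
  have : Num.min d ((g a - inf (g @` A)) / 2) <= (g a - inf (g @` A)) / 2.
    by rewrite ge_min lexx orbT.
  by move: gx; lra.
have [_ [c Ac <-]] := inf_adherent r0 hi.
by have := Ar c Ac; lra.
Qed.

End EuclideanNorm.

(** * Subadditivity of powers with exponent between 0 and 1 *)

Section PowerSubadditive.
Set Implicit Arguments.
Unset Strict Implicit.
Context {R : realType}.

Lemma powR_subadditive_lt (alpha x y : R) : 0 < alpha -> alpha < 1 -> 0 < x -> 0 < y ->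
  (x + y) `^ alpha < x `^ alpha + y `^ alpha.
Proof.
move=> a0 a1 x0 y0; have xy0 : 0 < x + y by lra.
(* a `^ alpha = a / a `^ (1 - alpha), and the denominator increases with a *)
have E (z : R) : 0 < z -> z <= x + y -> z * (x + y) `^ (alpha - 1) <= z `^ alpha.
  move=> z0 zxy; rewrite -(@mulr_powRB1 _ z alpha) ?(ltW z0)// ler_pM2l//.
  rewrite -opprB !powRN lef_pV2 ?posrE ?powR_gt0//.
  by rewrite ge0_ler_powR// ?nnegrE; lra.
have E' : x * (x + y) `^ (alpha - 1) < x `^ alpha.
  rewrite -(@mulr_powRB1 _ x alpha) ?(ltW x0)// ltr_pM2l//.
  rewrite -opprB !powRN ltf_pV2 ?posrE ?powR_gt0//.
  by rewrite gt0_ltr_powR// ?nnegrE; lra.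
rewrite -(@mulr_powRB1 _ (x + y) alpha) ?(ltW xy0)// mulrDl.
by apply: ltr_leD => //; apply: E; lra.
Qed.

Lemma powR_subadditive (alpha x y : R) : 0 < alpha -> alpha < 1 -> 0 <= x -> 0 <= y ->
  (x + y) `^ alpha <= x `^ alpha + y `^ alpha.
Proof.
move=> a0 a1; rewrite le_eqVlt => /predU1P[<- _|x0].
  by rewrite add0r lerDr powR_ge0.
rewrite le_eqVlt => /predU1P[<-|y0]; first by rewrite addr0 lerDl powR_ge0.
by rewrite ltW// powR_subadditive_lt.
Qed.

Lemma powR_rootK (x r : R) : r != 0 -> 0 <= x -> (x `^ r^-1) `^ r = x.
Proof. by move=> r0 x0; rewrite -powRrM mulVf// powRr1. Qed.

End PowerSubadditive.

(** * Bounded Lipschitz functions: finite slopes and attained steepest descent *)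

Section LipschitzBounded.
Set Implicit Arguments.
Unset Strict Implicit.
Context {R : realType} {n : nat}.
Implicit Types (alpha N B s : R) (x y z : 'rV[R]_n) (g w : 'rV[R]_n -> R).

Definition lip_bounded (N B : R) g :=
  (forall x y, g x - g y <= N * enorm (x - y)) /\ (forall x, `|g x| <= B).

Lemma lip_boundedB N B g : lip_bounded N B g ->
  forall x y, `|g x - g y| <= N * enorm (x - y).
Proof.
by move=> [gN _] x y; rewrite ler_norml lerNl opprB gN andbT enormBC gN.
Qed.

Lemma lip_bounded_locally_lipschitz N B g : lip_bounded N B g -> locally_lipschitz g.
Proof.
by move=> gN x; exists 1, N; split => // y z _ _; exact: lip_boundedB gN _ _.
Qed.

Lemma bounded_growth alpha B g : 0 < alpha -> (forall x, `|g x| <= B) -> growth alpha g.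
Proof.
move=> a0 gB; exists (B + 1), 0; split; last split => //.
  by have := le_trans (normr_ge0 _) (gB 0); lra.
by move=> x; rewrite powRr0 mulr1; apply: le_trans (gB x) _; lra.
Qed.

(** The Lipschitz bound serves at distances up to 1, where the distance is at most its power; the
    sup bound serves beyond. *)
Lemma lip_bounded_diff_le alpha N B g x y : 0 < alpha -> alpha < 1 -> 0 <= N ->
  lip_bounded N B g -> `|g y - g x| <= (N + 2 * B) * enorm (x - y) `^ alpha.
Proof.
move=> a0 a1 N0 gN; have B0 := le_trans (normr_ge0 _) (gN.2 x).
have gyx := lip_boundedB gN y x; rewrite enormBC in gyx.
have [yx|] := eqVneq (enorm (x - y)) 0.
  by rewrite yx mulr0 in gyx; apply: le_trans gyx _; rewrite mulr_ge0 ?powR_ge0//; lra.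
move=> yx; have E0 : 0 < enorm (x - y) by rewrite lt_neqAle eq_sym yx enorm_ge0.
have P0 := powR_ge0 (enorm (x - y)) alpha.
have [E1|E1] := lerP (enorm (x - y)) 1.
  have Ea : enorm (x - y) <= enorm (x - y) `^ alpha.
    by apply: ger1_powR; rewrite ?E0//; lra.
  by nra.
have Ea : 1 <= enorm (x - y) `^ alpha.
  by rewrite -(powRr0 (enorm (x - y))) ler_powR//; lra.
have := ler_normB (g y) (g x); have := gN.2 x; have := gN.2 y; nra.
Qed.

(* The slopes [p] and [s] are the real numbers L^+ g(x) and - L^- g(x). *)
Lemma Linf_lip_bounded alpha N B g x : (0 < n)%N -> 0 < alpha -> alpha < 1 ->
  0 <= N -> lip_bounded N B g -> exists p s : R, [/\
    Linf alpha g x = (p - s)%:E,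
    forall y, g y - g x <= p * enorm (x - y) `^ alpha,
    forall c, (forall y, g y - g x <= c * enorm (x - y) `^ alpha) -> p <= c,
    forall y, - s * enorm (x - y) `^ alpha <= g y - g x &
    forall c, (forall y, - c * enorm (x - y) `^ alpha <= g y - g x) -> s <= c].
Proof.
move=> n0 a0 a1 N0 gN.
pose D := [set diffq alpha g x y | y in [set y | y != x]].
have E0 y : y != x -> 0 < enorm (x - y) `^ alpha.
  by move=> yx; rewrite powR_gt0// enormB_gt0 eq_sym.
have Ex : enorm (x - x) `^ alpha = 0 by rewrite subrr enorm0 powR0// gt_eqF.
have D0 : D !=set0.
  have [t ht] := far_point n0 (addr_ge0 (enorm_ge0 x) ler01).
  exists (diffq alpha g x t), t => //=; apply/eqP => tx.
  by move: ht; rewrite tx; lra.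
have bnd y := lip_bounded_diff_le x y a0 a1 N0 gN.
have Dle c : (forall y, g y - g x <= c * enorm (x - y) `^ alpha) -> ubound D c.
  by move=> h _ [y /= yx <-]; rewrite /diffq ler_pdivrMr ?E0.
have Dge c : (forall y, c * enorm (x - y) `^ alpha <= g y - g x) -> lbound D c.
  by move=> h _ [y /= yx <-]; rewrite /diffq ler_pdivlMr ?E0.
have Du : has_ubound D.
  exists (N + 2 * B); apply: Dle => y.
  by have := bnd y; rewrite ler_norml => /andP[].
have Dl : has_lbound D.
  exists (- (N + 2 * B)); apply: Dge => y.
  by have := bnd y; rewrite ler_norml mulNr => /andP[].
exists (sup D), (- inf D); split.
- rewrite /Linf /Lplus /Lminus opprK EFinD -ereal_sup_EFin// -ereal_inf_EFin//.
  by rewrite /D !image_comp.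
- move=> y; have [->|yx] := eqVneq y x; first by rewrite Ex subrr mulr0.
  by rewrite -ler_pdivrMr ?E0//; apply: ub_le_sup => //; exists y.
- by move=> c /Dle; exact: ge_sup.
- move=> y; have [->|yx] := eqVneq y x; first by rewrite Ex subrr mulr0.
  by rewrite opprK -ler_pdivlMr ?E0//; apply: ge_inf => //; exists y.
- by move=> c /Dge h; rewrite lerNl; exact: lb_le_inf.
Qed.

Lemma lipschitz_lsc N g : 0 <= N ->
  (forall x y, g x - g y <= N * enorm (x - y)) -> lsc g.
Proof.
move=> N0 gN x e e0; exists (e / (N + 1)); split; first by rewrite divr_gt0//; lra.
move=> y; rewrite ltr_pdivlMr; last by lra.
by have := gN x y; rewrite enormBC; have := enorm_ge0 (y - x); nra.
Qed.

Lemma lscD g w : lsc g -> lsc w -> lsc (fun x => g x + w x).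
Proof.
move=> lg lw x e e0; have e2 : 0 < e / 2 by lra.
have [d [d0 hd]] := lg x _ e2; have [d' [d'0 hd']] := lw x _ e2.
exists (Num.min d d'); split; first by rewrite lt_min d0.
by move=> y; rewrite lt_min => /andP[/hd + /hd']; lra.
Qed.

(** By subadditivity the power of the distance obeys the triangle inequality. The radius is taken
    with [c + 1] to allow [c = 0]. *)
Lemma lsc_enorm_powR alpha c x : 0 < alpha -> alpha < 1 -> 0 <= c ->
  lsc (fun y => c * enorm (x - y) `^ alpha).
Proof.
move=> a0 a1 c0 y e e0; have c1 : 0 < c + 1 by lra.
exists ((e / (c + 1)) `^ alpha^-1); split; first by rewrite powR_gt0 ?divr_gt0.
move=> z /(gt0_ltr_powR a0); rewrite !nnegrE => /(_ (enorm_ge0 _) (powR_ge0 _ _)).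
rewrite powR_rootK ?gt_eqF// ?divr_ge0 ?(ltW e0) ?(ltW c1)// ltr_pdivlMr// => zy.
have : enorm (x - y) `^ alpha <= enorm (x - z) `^ alpha + enorm (z - y) `^ alpha.
  apply: le_trans (powR_subadditive a0 a1 (enorm_ge0 _) (enorm_ge0 _)).
  by rewrite ge0_ler_powR ?nnegrE ?addr_ge0 ?enorm_ge0 ?(ltW a0)//; exact: enorm_triangle.
have := powR_ge0 (enorm (z - y)) alpha; move: zy.
by move: (_ `^ _) (enorm (x - y) `^ _) (enorm (x - z) `^ _) => p q r; nra.
Qed.

(* For [alpha < 1] the difference quotients of a Lipschitz function vanish at
   [x], and those of a bounded one vanish at infinity. *)
Lemma slope_down_attained alpha N B g x s : 0 < alpha -> alpha < 1 -> 0 <= N ->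
  lip_bounded N B g -> 0 < s ->
  (forall c, (forall y, - c * enorm (x - y) `^ alpha <= g y - g x) -> s <= c) ->
  exists2 z, z != x & g z - g x <= - s * enorm (x - z) `^ alpha.
Proof.
move=> a0 a1 N0 gN s0 smin; have B0 := le_trans (normr_ge0 _) (gN.2 x).
(* Below distance [r] the Lipschitz bound, and beyond [b] the bound on [g], keep downward slopes at
   most [s / 2]; only the annulus in between matters. *)
pose r := (s / (2 * (N + 1))) `^ (1 - alpha)^-1.
pose b := (4 * (B + 1) / s) `^ alpha^-1.
have r0 : 0 < r by rewrite powR_gt0// divr_gt0//; lra.
have b0 : 0 < b by rewrite powR_gt0// divr_gt0//; lra.
have near_small y : enorm (x - y) < r -> - (s / 2) * enorm (x - y) `^ alpha <= g y - g x.
  have a1' : 0 < 1 - alpha by lra.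
  move=> /ltW h; have P0 := powR_ge0 (enorm (x - y)) alpha.
  have := enorm_ge0 (x - y); rewrite le_eqVlt => /predU1P[e0|e0].
    have := (lip_boundedB gN y x); rewrite enormBC -e0 mulr0 ler_norml => /andP[+ _].
    by have := mulr_ge0 (ltW s0) P0; rewrite -e0; nra.
  have : enorm (x - y) `^ (1 - alpha) <= s / (2 * (N + 1)).
    have q0 : 0 <= s / (2 * (N + 1)) by rewrite divr_ge0//; lra.
    rewrite -(@powR_rootK _ (s / (2 * (N + 1))) (1 - alpha)) ?gt_eqF//.
    by apply: ge0_ler_powR; rewrite ?nnegrE ?enorm_ge0// ltW.
  rewrite ler_pdivlMr; last by lra.
  have tE : enorm (x - y) `^ (1 - alpha) * enorm (x - y) `^ alpha = enorm (x - y).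
    by rewrite -powRD ?subrK ?powRr1 ?enorm_ge0// gt_eqF// implybT.
  have h1 := gN.1 x y; rewrite -tE in h1.
  have p0 := powR_ge0 (enorm (x - y)) (1 - alpha).
  move=> h2; have /= := ler_wpM2r P0 h2; have := mulr_ge0 p0 P0; nra.
have far_small y : b < enorm (x - y) -> - (s / 2) * enorm (x - y) `^ alpha <= g y - g x.
  have q0 : 0 <= 4 * (B + 1) / s by rewrite divr_ge0//; lra.
  move=> /(gt0_ltr_powR a0); rewrite !nnegrE => /(_ (ltW b0) (enorm_ge0 _)).
  rewrite powR_rootK ?gt_eqF// ltr_pdivrMr//.
  by have := ler_normB (g y) (g x); rewrite ler_norml; have := gN.2 x; have := gN.2 y; nra.
pose A := [set y | r <= enorm (x - y) <= b].
have oA : eopen (~` A).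
  move=> y /= /negP; rewrite negb_and -!ltNge => /orP[h|h].
    exists (r - enorm (x - y)); split; first by lra.
    move=> t ht; apply/negP; rewrite negb_and -!ltNge; apply/orP; left.
    by have := enorm_triangle y x t; rewrite (enormBC y t); lra.
  exists (enorm (x - y) - b); split; first by lra.
  move=> t ht; apply/negP; rewrite negb_and -!ltNge; apply/orP; right.
  by have := enorm_triangle t x y; lra.
have Ab y : A y -> enorm y <= b + enorm x.
  move=> /andP[_ h]; have := enorm_triangle x y 0.
  by rewrite !subr0 (enormBC y x); lra.
have inA y : ~ (- (s / 2) * enorm (x - y) `^ alpha <= g y - g x) -> A y.
  move=> h; rewrite /A /= !leNgt; apply/andP; split; apply/negP => h';
    apply: h; [exact: near_small|exact: far_small].
have A0 : A !=set0.
  apply: contrapT => nA; have : s <= s / 2; last by lra.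
  by apply: smin => y; apply: contrapT => /inA ?; apply: nA; exists y.
have hl : lsc (fun y => g y + s * enorm (x - y) `^ alpha).
  by apply: lscD (lipschitz_lsc N0 gN.1) (lsc_enorm_powR _ _ _ _) => //; exact: ltW.
have [z Az zmin] := lsc_attains_min oA Ab hl A0; exists z.
  by apply/eqP => zx; move: Az; rewrite /A /= zx subrr enorm0; lra.
rewrite leNgt; apply/negP => hz.
(* If the minimiser misses the slope by [mu > 0], then, distances in the annulus being at most [b],
   a constant below [s] is admissible, against the minimality of [s]. *)
pose mu := g z - g x + s * enorm (x - z) `^ alpha.
have mu0 : 0 < mu by rewrite /mu; lra.
have bp : 0 < b `^ alpha by rewrite powR_gt0.
have : s <= Num.max (s / 2) (s - mu / b `^ alpha).
  apply: smin => y; set c := Num.max _ _; have P0 := powR_ge0 (enorm (x - y)) alpha.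
  have c1 : s / 2 <= c by rewrite /c le_max lexx.
  have c2 : s - mu / b `^ alpha <= c by rewrite /c le_max lexx orbT.
  have [Ay|nAy] := pselect (A y); last first.
    have := contra_notP (@inA y) nAy; move: P0 c1.
    clearbody c; clear c2; move: (enorm (x - y) `^ alpha) => E.
    by clear; nra.
  have Eb : enorm (x - y) `^ alpha <= b `^ alpha.
    by case/andP: Ay => _ h; rewrite ge0_ler_powR ?nnegrE ?enorm_ge0 ?(ltW a0) ?(ltW b0).
  have muE : mu = g z - g x + s * enorm (x - z) `^ alpha by [].
  have /= := zmin y Ay; have /= := ler_wpM2r P0 c2.
  have : mu / b `^ alpha * enorm (x - y) `^ alpha <= mu.
    by rewrite -mulrA ger_pMr// mulrC ler_pdivrMr// mul1r.
  move: muE; clearbody mu c.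
  move: (enorm (x - y) `^ alpha) (enorm (x - z) `^ alpha) (b `^ alpha).
  by move=> E E' E''; clear; lra.
by rewrite le_max; have := divr_gt0 mu0 bp; lra.
Qed.

End LipschitzBounded.

(** * Inf-convolution of bounded functions, and two consecutive steepest steps *)

Section InfConvolution.
Set Implicit Arguments.
Unset Strict Implicit.
Context {R : realType} {n : nat}.
Implicit Types (alpha N B : R) (x y z h : 'rV[R]_n) (f g w : 'rV[R]_n -> R).

(** For bounded [w] and [0 <= N] this is the largest [N]-Lipschitz minorant of [w]. *)
Definition infconv N w x : R := inf [set w y + N * enorm (x - y) | y in setT].

Lemma infconv_le N B w x y : 0 <= N -> (forall z, `|w z| <= B) ->
  infconv N w x <= w y + N * enorm (x - y).
Proof.
move=> N0 wB; apply: ge_inf; last by exists y.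
exists (- B) => _ [z _ <-]; have := mulr_ge0 N0 (enorm_ge0 (x - z)).
by have := wB z; rewrite ler_norml; lra.
Qed.

Lemma le_infconv N w x (c : R) :
  (forall y, c <= w y + N * enorm (x - y)) -> c <= infconv N w x.
Proof.
move=> h; apply: lb_le_inf; first by exists (w x + N * enorm (x - x)), x.
by move=> _ [y _ <-].
Qed.

Lemma infconv_le_self N B w x : 0 <= N -> (forall z, `|w z| <= B) ->
  infconv N w x <= w x.
Proof.
by move=> N0 wB; have := infconv_le x x N0 wB; rewrite subrr enorm0 mulr0 addr0.
Qed.

Lemma infconv_lip_bounded N B w : 0 <= N -> (forall z, `|w z| <= B) ->
  lip_bounded N B (infconv N w).
Proof.
move=> N0 wB; split => [x y|x].
  rewrite lerBlDl -lerBlDr; apply: le_infconv => z.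
  have := infconv_le x z N0 wB; have := ler_wpM2l N0 (enorm_triangle y x z).
  by rewrite mulrDr; lra.
rewrite ler_norml; apply/andP; split; last first.
  by apply: le_trans (infconv_le_self x N0 wB) _; have := wB x; rewrite ler_norml; lra.
apply: le_infconv => z; have := mulr_ge0 N0 (enorm_ge0 (x - z)).
by have := wB z; rewrite ler_norml; lra.
Qed.

(** Beyond distance [2 * B / N] the penalty exceeds the oscillation of [w], so the infimum is a
    minimum over a closed ball. *)
Lemma infconv_attained N B w x : 0 < N -> (forall z, `|w z| <= B) -> lsc w ->
  exists z, infconv N w x = w z + N * enorm (x - z) /\ N * enorm (x - z) <= 2 * B.
Proof.
move=> N0 wB lw; have B0 := le_trans (normr_ge0 _) (wB x).
pose A := [set y | N * enorm (x - y) <= 2 * B].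
have oA : eopen (~` A).
  move=> y /= /negP; rewrite -ltNge => hy.
  exists ((N * enorm (x - y) - 2 * B) / N); split; first by rewrite divr_gt0//; lra.
  move=> t; rewrite ltr_pdivlMr// => ht; apply/negP; rewrite -ltNge.
  have := ler_wpM2l (ltW N0) (enorm_triangle t x y).
  by rewrite mulrDr; move: ht; rewrite mulrC; lra.
have Ab y : A y -> enorm y <= 2 * B / N + enorm x.
  rewrite /A /= mulrC -ler_pdivlMr// => hy; have := enorm_triangle x y 0.
  by rewrite !subr0 (enormBC y x); lra.
have hl : lsc (fun y => w y + N * enorm (x - y)).
  apply: lscD => //; apply: (@lipschitz_lsc _ _ N).
    exact: ltW.
  move=> y z; have := ler_wpM2l (ltW N0) (enorm_triangle z x y).
  by rewrite mulrDr (enormBC z y); lra.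
have Ax : A x by rewrite /A /= subrr enorm0; lra.
have [z Az zmin] := lsc_attains_min oA Ab hl (ex_intro _ x Ax).
exists z; split=> //; apply/eqP; rewrite eq_le (infconv_le _ _ (ltW N0) wB)/=.
apply: le_infconv => y; have [|nAy] := pselect (A y); first exact: zmin.
have := zmin x Ax; rewrite subrr enorm0 mulr0 addr0.
move: nAy => /negP; rewrite -ltNge.
by have := wB y; have := wB x; rewrite !ler_norml; lra.
Qed.

Lemma Linf_translate alpha g h (c : R) z :
  Linf alpha (fun y => g (y + h) - c) z = Linf alpha g (z + h).
Proof.
suff E : [set diffq alpha (fun y => g (y + h) - c) z y | y in [set y | y != z]] =
         [set diffq alpha g (z + h) y | y in [set y | y != z + h]].
  rewrite /Linf /Lplus /Lminus.
  by rewrite -(image_comp (diffq alpha _ z) EFin) E image_comp.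
have D y : diffq alpha (fun y => g (y + h) - c) z y = diffq alpha g (z + h) (y + h).
  have zy : z + h - (y + h) = z - y by rewrite opprD addrACA subrr addr0.
  by rewrite /diffq zy; congr (_ * _); ring.
apply/seteqP; split => _ [y /= yz <-].
  by exists (y + h); rewrite ?D//= (inj_eq (addIr h)).
exists (y - h); last by rewrite D subrK.
by apply: contra yz => /eqP <-; rewrite subrK.
Qed.

(* The translate of the inf-convolution by [x - z], lowered by the penalty,
   touches [u] from below at [z]. *)
Lemma Linf_infconv_le alpha (Omega : set 'rV[R]_n) f u N B x z :
  0 < alpha -> 0 <= N -> (forall z, `|u z| <= B) ->
  visc_super alpha Omega f u ->
  infconv N u x = u z + N * enorm (x - z) -> Omega z ->
  (Linf alpha (infconv N u) x <= (f z)%:E)%E.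
Proof.
move=> a0 N0 uB [_ [_ su]] xz Oz.
have gN := infconv_lip_bounded N0 uB.
have zx : z + (x - z) = x by rewrite addrC subrK.
have -> : Linf alpha (infconv N u) x =
    Linf alpha (fun y => infconv N u (y + (x - z)) - N * enorm (x - z)) z.
  by rewrite Linf_translate zx.
apply: su => //.
- move=> y; exists 1, N; split=> // p q _ _.
  have pq : p + (x - z) - (q + (x - z)) = p - q.
    by rewrite opprD addrACA subrr addr0.
  rewrite -pq; apply: le_trans (lip_boundedB gN _ _).
  by rewrite le_eqVlt; apply/orP; left; apply/eqP; congr `|_|; ring.
- apply: (@bounded_growth _ _ _ (B + N * enorm (x - z))) => // y.
  apply: le_trans (ler_normB _ _) _; rewrite lerD ?gN.2//.
  by rewrite ger0_norm// mulr_ge0 ?enorm_ge0.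
- by rewrite zx xz addrK.
move=> y; rewrite lerBlDr; have := infconv_le (y + (x - z)) y N0 uB.
by rewrite [y + _]addrC addrK.
Qed.

(* Two consecutive steps of slope at least [s] would descend by
   [s * (d `^ alpha + d' `^ alpha)], more than the slope [s] allows at distance
   [d + d']. *)
Lemma Linf_gt0_after_steepest_descent alpha N B g x z (s : R) :
  (0 < n)%N -> 0 < alpha -> alpha < 1 -> 0 <= N -> lip_bounded N B g -> 0 < s ->
  (forall y, - s * enorm (x - y) `^ alpha <= g y - g x) ->
  z != x -> g z - g x <= - s * enorm (x - z) `^ alpha ->
  (0%:E < Linf alpha g z)%E.
Proof.
move=> n0 a0 a1 N0 gN s0 hs zx hz; rewrite ltNge; apply/negP.
have [p [t [-> hp _ _ ht]]] := Linf_lip_bounded z n0 a0 a1 N0 gN.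
rewrite lee_fin => pt; have d0 : 0 < enorm (x - z) by rewrite enormB_gt0 eq_sym.
(* Going back from [z] to [x] shows an upward slope of at least [s]; [p - t <= 0] then passes this
   bound to the downward slope [t]. *)
have sp : s <= p.
  have P0 : 0 < enorm (x - z) `^ alpha by rewrite powR_gt0.
  by rewrite -(ler_pM2r P0); have := hp x; rewrite (enormBC z x); lra.
have st : s <= t by clear - pt sp; lra.
have t0 : 0 < t by exact: lt_le_trans st.
have [z' z'z hz'] := slope_down_attained a0 a1 N0 gN t0 ht.
have d'0 : 0 < enorm (z - z') by rewrite enormB_gt0 eq_sym.
have : enorm (x - z') `^ alpha < enorm (x - z) `^ alpha + enorm (z - z') `^ alpha.
  apply: le_lt_trans (powR_subadditive_lt a0 a1 d0 d'0).
  rewrite ge0_ler_powR ?nnegrE ?addr_ge0 ?enorm_ge0 ?(ltW a0)//.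
  exact: enorm_triangle.
rewrite -(ltr_pM2l s0) mulrDr.
have /= := ler_wpM2r (powR_ge0 (enorm (z - z')) alpha) st.
have := hs z'; move: hz hz'.
move: (enorm (x - z) `^ alpha) (enorm (z - z') `^ alpha) => e e'.
by move: (enorm (x - z') `^ alpha) => e''; clear; lra.
Qed.

End InfConvolution.

(** * Behaviour near the complement of the domain, and the two viscosity inequalities compared *)

Section Comparison.
Set Implicit Arguments.
Unset Strict Implicit.
Context {R : realType} {n : nat}.
Implicit Types (x y z p : 'rV[R]_n) (f u v : 'rV[R]_n -> R) (Omega : set 'rV[R]_n).

Lemma usc_oppr v : usc v -> lsc (fun x => - v x).
Proof.
move=> uv x e e0; have [d [d0 hd]] := uv x e e0.
by exists d; split => // y /hd; lra.
Qed.

(** The limit bounds [u] outside a large ball, the growth condition inside. The exponent [b] may be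
    negative, hence its absolute value. *)
Lemma growth_lim_bounded (alpha c : R) u : growth alpha u -> lim_at_infty u c ->
  exists B, forall x, `|u x| <= B.
Proof.
move=> [C [b [C0 [_ hC]]]] /(_ 1 ltr01)[M hM].
exists (Num.max (C * (1 + `|M|) `^ `|b|) (`|c| + 1)) => x; rewrite le_max.
have [xM|/hM h] := lerP (enorm x) M; last first.
  by apply/orP; right; have := lerB_dist (u x) c; lra.
apply/orP; left; apply: le_trans (hC x) _; rewrite ler_pM2l//.
have x1 : 1 <= 1 + enorm x by have := enorm_ge0 x; lra.
apply: (@le_trans _ _ ((1 + enorm x) `^ `|b|)); first by rewrite ler_powR// ler_norm.
by rewrite ge0_ler_powR ?nnegrE ?normr_ge0//; have := ler_norm M; lra.
Qed.

Lemma lim_at_infty_le Omega u v (c c' : R) : (0 < n)%N -> ebounded Omega ->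
  (forall x, ~ Omega x -> v x <= u x) ->
  lim_at_infty u c -> lim_at_infty v c' -> c' <= c.
Proof.
move=> n0 [M OM] vu hu hv; rewrite leNgt; apply/negP => cc.
have e0 : 0 < (c' - c) / 2 by lra.
have [Mu hMu] := hu _ e0; have [Mv hMv] := hv _ e0.
have t0 : 0 <= `|M| + `|Mu| + `|Mv| + 1 by rewrite !addr_ge0.
have [x hx] := far_point n0 t0.
have := ler_norm M; have := ler_norm Mu; have := ler_norm Mv.
have := normr_ge0 M; have := normr_ge0 Mu; have := normr_ge0 Mv => h1 h2 h3 h4 h5 h6.
have ux : `|u x - c| < (c' - c) / 2 by apply: hMu; rewrite hx; lra.
have vx : `|v x - c'| < (c' - c) / 2 by apply: hMv; rewrite hx; lra.
have : v x <= u x by apply: vu => /OM; lra.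
by move: ux vx; rewrite !ltr_norml; lra.
Qed.

(** Semicontinuity and compactness give the radius in a large ball; farther out the limits do. Two
    points [x], [y] appear because the inf-convolution evaluates [u] at a displaced point. *)
Lemma separation_off_domain Omega u v (c c' e : R) : (0 < n)%N ->
  eopen Omega -> ebounded Omega -> lsc u -> usc v ->
  (forall x, ~ Omega x -> v x <= u x) ->
  lim_at_infty u c -> lim_at_infty v c' -> 0 < e ->
  exists r, 0 < r /\ forall p x y, ~ Omega p ->
    enorm (x - p) < r -> enorm (y - p) < r -> v x - u y < e.
Proof.
move=> n0 oO bO lu uv vu hu hv e0; have cc := lim_at_infty_le n0 bO vu hu hv.
have e2 : 0 < e / 2 by lra.
have [Mu hMu] := hu _ e2; have [Mv hMv] := hv _ e2.
pose M := Num.max Mu Mv + 1.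
pose A := [set p | ~ Omega p /\ enorm p <= M].
have oA : eopen (~` A).
  move=> p /= nAp; have [Op|nOp] := pselect (Omega p).
    by have [r [r0 hr]] := oO p Op; exists r; split=> // y /hr Oy [].
  have pM : M < enorm p by rewrite ltNge; apply/negP => pM; exact: nAp.
  exists (enorm p - M); split; first by lra.
  move=> y yp [_]; have := enorm_triangle y p 0.
  by rewrite !subr0 (enormBC p y); lra.
have [|||r [r0 hr]] := @uniform_on_compact _ _ A M (fun r p => forall x y,
  enorm (x - p) < r -> enorm (y - p) < r -> v x - u y < e) oA.
- by move=> p [].
- by move=> r s p sr h x y hx hy; apply: h; lra.
- move=> p [nOp _]; have [d [d0 hd]] := lu p _ e2; have [d' [d'0 hd']] := uv p _ e2.
  pose m := Num.min d d'.
  have m0 : 0 < m by rewrite lt_min d0.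
  have md : m <= d by rewrite ge_min lexx.
  have md' : m <= d' by rewrite ge_min lexx orbT.
  exists (m / 2); split; first by lra.
  move=> q qp x y xq yq.
  have ux : v x < v p + e / 2.
    by apply: hd'; have := enorm_triangle q x p; lra.
  have uy : u p - e / 2 < u y.
    by apply: hd; have := enorm_triangle q y p; lra.
  by have := vu p nOp; lra.
(* The cap 1 matches the margin in [M]: points within 1 of a far [p] still have norm above [Mu] and
   [Mv]. *)
exists (Num.min r 1); split; first by rewrite lt_min r0/=.
move=> p x y nOp; rewrite !lt_min => /andP[xr x1] /andP[yr y1].
have [pM|Mp] := lerP (enorm p) M; first exact: (hr p).
have far z : enorm (z - p) < 1 -> Mu < enorm z /\ Mv < enorm z.
  move=> zp; have := enorm_triangle z p 0; rewrite !subr0 (enormBC p z).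
  have : Mu <= Num.max Mu Mv by rewrite le_max lexx.
  have : Mv <= Num.max Mu Mv by rewrite le_max lexx orbT.
  by move: Mp; rewrite /M; split; lra.
have [_ /hMv] := far x x1; have [/hMu + _] := far y y1.
by rewrite !ltr_norml; lra.
Qed.

(** Continuity of [f] is given on an open set, so uniformity is obtained on the compact set of
    points at distance at least [r] from the complement. *)
Lemma uniformly_continuous_inside Omega f (r e : R) : eopen Omega -> ebounded Omega ->
  continuous_on Omega f -> 0 < r -> 0 < e ->
  exists d, 0 < d /\ forall x y, (forall p, ~ Omega p -> r <= enorm (x - p)) ->
    enorm (y - x) < d -> Omega y -> `|f y - f x| < e.
Proof.
move=> oO [M OM] cf r0 e0.
pose A := [set x | forall p, ~ Omega p -> r <= enorm (x - p)].
have AO x : A x -> Omega x.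
  by move=> Ax; apply: contrapT => /Ax; rewrite subrr enorm0; lra.
have oA : eopen (~` A).
  move=> x nAx; have [p [nOp xp]] : exists p, ~ Omega p /\ enorm (x - p) < r.
    apply: contrapT => h; apply: nAx => p nOp; rewrite leNgt; apply/negP => xp.
    by apply: h; exists p.
  exists (r - enorm (x - p)); split; first by lra.
  move=> y yx /(_ p nOp); have := enorm_triangle x y p; lra.
have e2 : 0 < e / 2 by lra.
have [|||d [d0 hd]] := @uniform_on_compact _ _ A M (fun d x => forall y,
  enorm (y - x) < d -> Omega y -> Omega x -> `|f y - f x| < e) oA.
- by move=> x /AO /OM.
- by move=> s t x ts h y hy; apply: h; lra.
- move=> x Ax; have [d [d0 hd]] := cf x _ (AO x Ax) e2.
  exists (d / 2); split; first by lra.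
  move=> z zx y yz Oy Oz.
  have : `|f y - f x| < e / 2.
    by apply: hd => //; have := enorm_triangle z y x; lra.
  have : `|f z - f x| < e / 2 by apply: hd => //; lra.
  by rewrite !ltr_norml; lra.
exists d; split=> // x y Ax yx Oy; apply: (hd x) => //; exact: AO.
Qed.

(** The witness, the inf-convolution of the indicator of [Omega] with slope [r^-1], is the distance
    to the complement divided by [r], cut at 1. *)
Lemma cutoff_exists Omega (r : R) : 0 < r -> exists W : 'rV[R]_n -> R,
  [/\ lip_bounded r^-1 1 W, forall x, 0 <= W x <= 1,
      forall x p, ~ Omega p -> W x * r <= enorm (x - p) &
      forall x, (forall p, ~ Omega p -> r <= enorm (x - p)) -> W x = 1].
Proof.
move=> r0; have rN : 0 <= r^-1 by rewrite invr_ge0 ltW.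
pose w (x : 'rV[R]_n) : R := if `[< Omega x >] then 1 else 0.
have wB x : `|w x| <= 1 by rewrite /w; case: ifP; rewrite ?normr1 ?normr0.
have W1 x : infconv r^-1 w x <= 1.
  by apply: le_trans (infconv_le_self x rN wB) _; rewrite /w; case: ifP.
exists (infconv r^-1 w); split.
- exact: infconv_lip_bounded.
- move=> x; rewrite W1 andbT; apply: le_infconv => y.
  by rewrite addr_ge0 ?mulr_ge0 ?enorm_ge0// /w; case: ifP.
- move=> x p nOp; rewrite -ler_pdivlMr//; apply: le_trans (infconv_le x p rN wB) _.
  by rewrite /w; case: asboolP => // _; rewrite add0r mulrC.
move=> x h; apply/eqP; rewrite eq_le W1; apply: le_infconv => p.
rewrite /w; case: asboolP => [_|/h xp].
  by rewrite lerDl mulr_ge0 ?enorm_ge0.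
by rewrite add0r mulrC ler_pdivlMr// mul1r.
Qed.

(* The test function [g + const - e * (1 - W)] still touches [v] from above at
   [x]. *)
Lemma subsolution_slope_gap (alpha N B K e a d : R) Omega f v g W x :
  (0 < n)%N -> 0 < alpha -> alpha < 1 ->
  0 <= N -> lip_bounded N B g -> 0 <= K -> lip_bounded K 1 W ->
  (forall y, 0 <= W y <= 1) -> W x = 1 -> 0 < e ->
  visc_sub alpha Omega f v -> Omega x ->
  (forall y, v y - g y <= v x - g x) ->
  (forall y, W y < 1 -> v y - g y <= v x - g x - e) ->
  (Linf alpha g x <= a%:E)%E -> a <= 0 -> a - d <= f x ->
  exists s, [/\ forall y, - s * enorm (x - y) `^ alpha <= g y - g x,
    forall c, (forall y, - c * enorm (x - y) `^ alpha <= g y - g x) -> s <= c,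
    forall y, g y - g x <= s * enorm (x - y) `^ alpha &
    forall y, e * (1 - W y) - d * enorm (x - y) `^ alpha <=
      g y - g x + s * enorm (x - y) `^ alpha].
Proof.
move=> n0 a0 a1 N0 gN K0 WK W01 Wx e0 [_ [_ tv]] Ox vg vge Lg an ad.
pose phi y := g y + (v x - g x) - e * (1 - W y).
have phix : phi x = v x by rewrite /phi Wx; ring.
have phiN : lip_bounded (N + e * K) (B + `|v x - g x| + e) phi.
  split=> [y z|y].
    have := gN.1 y z; have := ler_wpM2l (ltW e0) (WK.1 y z).
    by rewrite mulrDl -mulrA /phi mulrBr; lra.
  have := gN.2 y; have := ler_norm (v x - g x); have := ler_norm (- (v x - g x)).
  by rewrite normrN; have := W01 y; rewrite /phi !ler_norml; nra.
have v_phi y : v y <= phi y.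
  have := W01 y; rewrite /phi; have [W1|W1] := ltrP (W y) 1.
    by have := vge y W1; nra.
  by have := vg y; nra.
have Lphi := tv x Ox phi (lip_bounded_locally_lipschitz phiN)
  (bounded_growth a0 phiN.2) phix v_phi.
have NK0 : 0 <= N + e * K by rewrite addr_ge0// mulr_ge0// ltW.
have [p [s [gE hp _ hs smin]]] := Linf_lip_bounded x n0 a0 a1 N0 gN.
have [q [t [phiE _ qmin ht _]]] := Linf_lip_bounded x n0 a0 a1 NK0 phiN.
rewrite gE lee_fin in Lg; rewrite phiE lee_fin in Lphi.
(* Lowering away from [x] cannot raise the upward slope. Hence [a - d <= f x <= q - t <= p - t], and
   [p - s <= a] yields [t <= s + d]. *)
have qp : q <= p.
  apply: qmin => y; apply: le_trans (hp y); rewrite phix /phi.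
  by have := W01 y; nra.
have ts : t <= s + d by lra.
exists s; split=> // y.
  by apply: le_trans (hp y) _; rewrite ler_wpM2r ?powR_ge0//; lra.
have /= := ler_wpM2r (powR_ge0 (enorm (x - y)) alpha) ts.
by have := ht y; rewrite phix /phi; lra.
Qed.

(** The gap at [z], where [W] vanishes, bounds [s] below by [e / (4 * D)]. As [g] varies by at most
    [2 * B], steepest steps have bounded length, and the gap at the end point [y] gives
    [e * (1 - W y) <= e / 4]. *)
Lemma steepest_step_stays_inside (alpha N B K e a d D : R) Omega f v g W x z :
  (0 < n)%N -> 0 < alpha -> alpha < 1 ->
  0 <= N -> lip_bounded N B g -> 0 <= K -> lip_bounded K 1 W ->
  (forall y, 0 <= W y <= 1) -> W x = 1 -> 0 < e ->
  visc_sub alpha Omega f v -> Omega x ->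
  (forall y, v y - g y <= v x - g x) ->
  (forall y, W y < 1 -> v y - g y <= v x - g x - e) ->
  (Linf alpha g x <= a%:E)%E -> a <= 0 -> a - d <= f x ->
  W z = 0 -> 0 < D -> enorm (x - z) `^ alpha <= D ->
  0 <= d -> d * (2 * D) <= e -> d * (8 * B) <= e * (e / (4 * D)) ->
  exists s y, [/\ 0 < s, forall t, - s * enorm (x - t) `^ alpha <= g t - g x,
    y != x, g y - g x <= - s * enorm (x - y) `^ alpha & 1 / 2 < W y].
Proof.
move=> n0 a0 a1 N0 gN K0 WK W01 Wx e0 sv Ox vg vge Lg an ad Wz D0 xzD d0 dD dB.
have [s [hs smin hs' gap]] := subsolution_slope_gap
  n0 a0 a1 N0 gN K0 WK W01 Wx e0 sv Ox vg vge Lg an ad.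
have s_ge : e / (4 * D) <= s.
  rewrite ler_pdivrMr ?mulr_gt0//.
  have := gap z; have := hs' z; rewrite Wz subr0 mulr1.
  move: xzD (powR_ge0 (enorm (x - z)) alpha).
  move: (_ `^ _) (g z - g x) => E G ED E0 h1 h2.
  have h3 : e <= (2 * s + d) * E by lra.
  have c0 : 0 < 2 * s + d.
    by rewrite ltNge; apply/negP => c; have := mulr_le0_ge0 c E0; clear - h3 e0; lra.
  have := le_trans h3 (ler_wpM2l (ltW c0) ED).
  by clear - dD; lra.
have eD0 : 0 < e / (4 * D) by rewrite divr_gt0// mulr_gt0.
have s0 : 0 < s by exact: lt_le_trans s_ge.
have [y yx hy] := slope_down_attained a0 a1 N0 gN s0 smin.
exists s, y; split=> //.
have gxy : g x - g y <= 2 * B.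
  by have := gN.2 y; have := gN.2 x; rewrite !ler_norml; clear; lra.
move: (gap y) hy (powR_ge0 (enorm (x - y)) alpha).
move: (_ `^ _) => E h1 h2 E0; have sE : s * E <= 2 * B by clear - h2 gxy; lra.
have h3 : e / (4 * D) * E <= 2 * B by apply: le_trans sE; rewrite ler_wpM2r.
have h4 : d * E <= e / 4.
  have /= h5 := ler_wpM2l d0 h3.
  by rewrite -(ler_pM2l eD0); lra.
rewrite -(ltr_pM2l e0); lra.
Qed.

End Comparison.

(** * Comparison principle: choice of the scales, then the contradiction *)

Theorem mainTheorem4 (R : realType) (n : nat) (alpha : R)
  (Omega : set 'rV[R]_n) (f u v : 'rV[R]_n -> R) (C1 C2 : R) :
  (0 < n)%N -> 0 < alpha -> alpha < 1 ->
  bounded_domain Omega ->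
  continuous_on Omega f ->
  (exists M : R, forall x, Omega x -> `|f x| <= M) ->
  (forall x, Omega x -> f x <= 0) ->
  visc_super alpha Omega f u ->
  visc_sub alpha Omega f v ->
  (exists M : R, forall x, ~ Omega x -> `|u x| <= M) ->
  (forall x, ~ Omega x -> v x <= u x) ->
  lim_at_infty u C1 -> lim_at_infty v C2 ->
  forall x, Omega x -> v x <= u x.
Proof.
move=> n0 a0 a1 [_ [oO [_ bO]]] cf _ f0 su sv _ vu hu hv xb Oxb.
have [lu [gu _]] := su; have [uv [gv tv]] := sv.
rewrite leNgt; apply/negP => uvb.
pose m := v xb - u xb; have m0 : 0 < m by rewrite /m; lra.
have [B [B0 uB]] : exists B, 0 < B /\ forall x, `|u x| <= B.
  have [B uB] := growth_lim_bounded gu hu; have := le_trans (normr_ge0 _) (uB 0).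
  by exists (B + 1); split; [lra|move=> x; apply: le_trans (uB x) _; lra].
have e0 : 0 < m / 2 by lra.
have [r2 [r20 sep]] := separation_off_domain n0 oO bO lu uv vu hu hv e0.
(* Halving leaves room for the minimisers of the inf-convolution, displaced by at most [r / 8]. *)
pose r := r2 / 2; have r0 : 0 < r by rewrite /r; lra.
have [M [M0 OM]] : exists M, 0 <= M /\ forall x, Omega x -> enorm x <= M.
  have [M OM] := bO; exists `|M|; split=> // x /OM; have := ler_norm M; lra.
(* Bounds the power of the distance from a point of [Omega] to the exterior point [z0] of norm
   [M + 1]. *)
pose D1 := (2 * M + 1) `^ alpha; have D10 : 0 < D1 by rewrite powR_gt0; lra.
have e2 : 0 < m / 2 / (4 * D1) by rewrite divr_gt0//; lra.
(* The tolerated oscillation of [f]: the two smallness conditions of [steepest_step_stays_inside]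
   with [e = m / 2] and [D = D1]. *)
pose de := Num.min (m / 2 / (2 * D1)) (m / 2 * (m / 2 / (4 * D1)) / (8 * B)).
have D20 : 0 < 2 * D1 by lra.
have B80 : 0 < 8 * B by lra.
have de0 : 0 < de by rewrite lt_min !divr_gt0// mulr_gt0.
have de1 : de * (2 * D1) <= m / 2 by rewrite -ler_pdivlMr// ge_min lexx.
have de2 : de * (8 * B) <= m / 2 * (m / 2 / (4 * D1)).
  by rewrite -ler_pdivlMr// ge_min lexx orbT.
have [rho [rho0 fcont]] := uniformly_continuous_inside oO bO cf r0 de0.
pose k := Num.min rho (r / 4); have k0 : 0 < k by rewrite lt_min rho0; lra.
have krho : k <= rho by rewrite ge_min lexx.
have kr : k <= r / 4 by rewrite ge_min lexx orbT.
(* As the penalty at a minimiser is at most [2 * B], this puts minimisers within [k / 2]. *)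
pose N := 4 * B / k; have N0 : 0 < N by rewrite divr_gt0//; lra.
have Nk : N * k = 4 * B by rewrite /N divfK ?gt_eqF.
clearbody N k de.
have proj x : exists y, infconv N u x = u y + N * enorm (x - y) /\ enorm (x - y) <= k / 2.
  have [y [xy hy]] := infconv_attained x N0 uB lu; exists y; split=> //.
  by rewrite -(ler_pM2l N0); lra.
pose g := infconv N u; have gN : lip_bounded N B g := infconv_lip_bounded (ltW N0) uB.
have [W [WN W01 Wnear Wfar]] := cutoff_exists Omega r0.
have near_out x p : ~ Omega p -> enorm (x - p) < r -> v x - g x < m / 2.
  move=> nOp xp; have [y [xy hy]] := proj x; rewrite /g xy.
  have := mulr_ge0 (ltW N0) (enorm_ge0 (x - y)).
  suff : v x - u y < m / 2 by lra.
  apply: (sep p) => //; first by rewrite /r in xp; lra.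
  have := enorm_triangle x y p; rewrite (enormBC y x); move: xp kr; rewrite /r; lra.
have inside x : m / 2 <= v x - g x -> forall p, ~ Omega p -> r <= enorm (x - p).
  by move=> h p nOp; rewrite leNgt; apply/negP => /(near_out x p nOp); lra.
have gb : m <= v xb - g xb.
  by rewrite /m lerD2l lerN2; exact: infconv_le_self (ltW N0) uB.
(* The maximum is sought in a closed ball containing [Omega]; outside it [v - g] is below [m / 2],
   while at [xb] it is at least [m]. *)
have [xh xhmax] : exists xh, forall x, v x - g x <= v xh - g xh.
  pose A := [set x : 'rV[R]_n | enorm x <= M].
  have oA : eopen (~` A).
    move=> y /= /negP; rewrite -ltNge => yM; exists (enorm y - M); split; first by lra.
    move=> t ty tM; have : enorm t <= M := tM.
    by have := enorm_triangle t y 0; rewrite !subr0 (enormBC y t); lra.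
  have lgv : lsc (fun x => g x + - v x).
    exact: lscD (lipschitz_lsc (ltW N0) gN.1) (usc_oppr uv).
  have [z Az zmin] := lsc_attains_min oA (fun x Ax => Ax) lgv
    (ex_intro _ xb (OM xb Oxb)).
  exists z => x; have := zmin _ (OM _ Oxb).
  have [|xM] := lerP (enorm x) M; first by move=> /zmin; lra.
  have nOx : ~ Omega x by move=> /OM; lra.
  by have := near_out x x nOx; rewrite subrr enorm0 => /(_ r0); lra.
have mc : m <= v xh - g xh by apply: le_trans gb (xhmax _).
have xh_in : forall p, ~ Omega p -> r <= enorm (xh - p) by apply: inside; lra.
have Oxh : Omega xh by apply: contrapT => /xh_in; rewrite subrr enorm0; lra.
have [yh [xyh hyh]] := proj xh.
have Oyh : Omega yh by apply: contrapT => /xh_in; lra.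
have fxy : f yh - de <= f xh.
  have : `|f yh - f xh| < de by apply: fcont => //; rewrite enormBC; lra.
  by rewrite ltr_norml; lra.
(* Where [W < 1], the complement is closer than [r], so [v - g < m / 2], whereas the maximum is at
   least [m]. *)
have Wlow x : W x < 1 -> v x - g x <= v xh - g xh - m / 2.
  have [/inside/Wfar ->|h _] := lerP (m / 2) (v x - g x); first by rewrite ltxx.
  by lra.
have [z0 hz0] := far_point n0 (addr_ge0 M0 ler01).
have nOz0 : ~ Omega z0 by move=> /OM; rewrite hz0; lra.
have Wz0 : W z0 = 0.
  have := Wnear z0 z0 nOz0; rewrite subrr enorm0 pmulr_lle0// => W0.
  by apply/eqP; rewrite eq_le W0; case/andP: (W01 z0).
have Ez0 : enorm (xh - z0) `^ alpha <= D1.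
  rewrite ge0_ler_powR ?nnegrE ?enorm_ge0 ?(ltW a0)//; first lra.
  have := enorm_triangle 0 xh z0; rewrite subr0 sub0r enormN hz0.
  by have := OM _ Oxh; lra.
have rN : 0 <= r^-1 by rewrite invr_ge0 ltW.
have Lxh := Linf_infconv_le a0 (ltW N0) uB su xyh Oyh.
have [s [z [s_gt0 hs zx hz Wz]]] := steepest_step_stays_inside
  n0 a0 a1 (ltW N0) gN rN WN W01 (Wfar _ xh_in) e0 sv Oxh xhmax Wlow
  Lxh (f0 _ Oyh) fxy Wz0 D10 Ez0 (ltW de0) de1 de2.
have [y [zy hy]] := proj z.
(* [W z > 1 / 2] keeps [z] farther than [r / 2] from the complement, and [y] is within
   [k / 2 <= r / 8] of [z]. *)
have Oy : Omega y.
  apply: contrapT => /(Wnear z); have := ltr_pM2r r0 (1 / 2) (W z); rewrite Wz.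
  by clear - hy kr r0; lra.
(* The steepest step forces a positive [Linf] of [g] at [z], but [y] in [Omega] bounds it by
   [f y <= 0]. *)
have := Linf_gt0_after_steepest_descent n0 a0 a1 (ltW N0) gN s_gt0 hs zx hz.
apply/negP; rewrite -leNgt.
apply: le_trans (Linf_infconv_le a0 (ltW N0) uB su zy Oy) _.
by rewrite lee_fin f0.
Qed.
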